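(* Let $G=(V;E)$ be the random graph. Let $\mathscr M$ be a locally closed monoid of mappings $V\to V$ (under composition) which contains the automorphism group $\mathrm{Aut}(G)$. Then at least one of the following holds: (1) $\mathscr M$ contains a constant operation; (2) $\mathscr M$ contains $e_E$; (3) $\mathscr M$ contains $e_N$; (4) $\mathscr M$ equals the smallest locally closed monoid of maps $V\to V$ that contains all permutations of $V$ belonging to $\mathscr M$ (i.e. $\mathscr M$ is generated by the permutations it contains).
   Context: The random graph $G=(V;E)$ is the unique (up to isomorphism) countably infinite graph such that for all finite disjoint $U,U'\subseteq V$ there is $v\in V\setminus(U\cup U')$ adjacent to every vertex of $U$ and to no vertex of $U'$. A monoid $\mathscr M$ of maps $D\to D$ is locally closed if whenever $f:D\to D$ is such that for every finite $A\subseteq D$ some $e\in\mathscr M$ agrees with $f$ on $A$, then $f\in\mathscr M$ (equivalently, $\mathscr M$ is closed in the product topology on $D^D$ with $D$ discrete). $e_E$ denotes a fixed injective map $V\to V$ whose image induces an infinite complete graph in $G$, and $e_N$ a fixed injective map $V\to V$ whose image induces an infinite independent set in $G$ (any two choices of such maps generate the same locally closed monoid together with $\mathrm{Aut}(G)$). *)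

(* Defs.v *)
From mathcomp Require Import all_boot.
From mathcomp Require Import boolp classical_sets functions cardinality.

Set Implicit Arguments.
Unset Strict Implicit.
Unset Printing Implicit Defensive.

Local Open Scope classical_set_scope.

(* A graph on V is given by its adjacency relation. Any two structures
   satisfying this predicate are isomorphic, so "the" random graph is rendered
   as an arbitrary one. *)
Definition random_graph (V : Type) (E : rel V) : Prop :=
  [/\ countable [set: V] /\ infinite_set [set: V],
      symmetric E,
      irreflexive E
    & forall U U' : set V, finite_set U -> finite_set U' ->
        U `&` U' = set0 ->
        exists v, [/\ ~ (U `|` U') v,
                      forall u, U u -> E v u
                    & forall u, U' u -> ~~ E v u]].

Definition graph_aut (V : Type) (E : rel V) : set (V -> V) :=
  [set f | bijective f /\ forall x y, E (f x) (f y) = E x y].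

Definition locally_closed (D : Type) (M : set (D -> D)) : Prop :=
  forall f : D -> D,
    (forall A : set D, finite_set A ->
       exists2 e, M e & forall x, A x -> e x = f x) ->
    M f.

Definition map_monoid (D : Type) (M : set (D -> D)) : Prop :=
  M id /\ forall f g, M f -> M g -> M (f \o g).

Definition locally_closed_monoid (D : Type) (M : set (D -> D)) : Prop :=
  map_monoid M /\ locally_closed M.

Definition all_perms (D : Type) : set (D -> D) := [set f | bijective f].

Definition infinite_clique (V : Type) (E : rel V) (S : set V) : Prop :=
  infinite_set S /\ forall x y, S x -> S y -> x <> y -> E x y.

Definition infinite_independent (V : Type) (E : rel V) (S : set V) : Prop :=
  infinite_set S /\ forall x y, S x -> S y -> x <> y -> ~~ E x y.

(* Main.v *)
Require Import Defs.
From mathcomp Require Import all_boot.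
From mathcomp Require Import perm.
From mathcomp Require Import boolp classical_sets functions cardinality.

Set Implicit Arguments.
Unset Strict Implicit.
Unset Printing Implicit Defensive.

(** If some elements of M identify the ends of an edge and others those of a
    nonedge, then M contains a constant. If only edges can be collapsed, then M
    preserves nonedges and kills edges one at a time, which gives e_N; dually
    for e_E. So let M consist of injections and omit e_E and e_N.

    By the Hales-Jewett theorem and the partite construction, given f in M and a
    finite set s, there are arbitrarily large families of places, with all types
    over s, such that on every graph realised at these places the effect of f
    on the pair {i, j} depends only on i, j and on whether that pair is an edge.
    If such a "pattern" sends both edges and nonedges at one pair to the same
    value, composing its images under permutations makes it constant at every
    pair, and Ramsey's theorem gives e_E or e_N. Hence large patterns only flip
    a fixed set of pairs. This set is a cut or the complement of a cut, since
    otherwise a combination of its images under permutations is a single pair,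
    and killing that pair when it is present is a constant pattern. Undoing the
    cut and the complement, and repeating the argument for the pairs meeting s,
    shows that f acts on s by switching and complementing operations that M
    realises on all finite graphs. Switching at finitely many vertices and
    complementing turn the random graph into an isomorphic graph, so by
    back-and-forth f agrees on s with a bijection, which lies in M. *)

(** * Hales-Jewett and Ramsey theorems *)

Definition line_point (J L : finType) (l : {ffun J -> option L}) (x : L) :
  {ffun J -> L} := [ffun j => odflt x (l j)].

Definition is_line (J L : finType) (l : {ffun J -> option L}) : bool :=
  [exists j, l j == None].

(* Colour focusing: [r] lines, each of one colour on [b :: s], the colours distinct, all meeting at the letter [a]; for [r > #|C|] this alternative is void. *)
Lemma hales_jewett_focus (L C : finType) (a b : L) (s : seq L) :
  (forall C' : finType, exists J : finType,
     forall chi : {ffun J -> L} -> C', exists2 l, is_line l &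
     {in b :: s, forall x, chi (line_point l x) = chi (line_point l b)}) ->
  forall r, exists J : finType, forall chi : {ffun J -> L} -> C,
    (exists2 l, is_line l &
       {in a :: b :: s, forall x, chi (line_point l x) = chi (line_point l b)}) \/
    (exists (w : {ffun J -> L}) (cs : seq C), [/\ uniq cs, size cs = r &
       {in cs, forall c, exists l, [/\ is_line l, line_point l a = w &
          {in b :: s, forall x, chi (line_point l x) = c}]}]).
Proof.
move=> HJ; elim=> [|r [J2 IH]].
  by exists unit => chi; right; exists [ffun=> a], [::]; split.
have [J1 {}HJ] := HJ {ffun {ffun J2 -> L} -> C}.
exists (J1 + J2)%type => chi.
pose cat2 X (u : {ffun J1 -> X}) (w : {ffun J2 -> X}) : {ffun J1 + J2 -> X} :=
  [ffun j => match j with inl i => u i | inr i => w i end].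
have [l1 l1P l1s] := HJ (fun u => [ffun w => chi (cat2 _ u w)]).
have l1E x w : x \in b :: s ->
    chi (cat2 _ (line_point l1 x) w) = chi (cat2 _ (line_point l1 b) w).
  by move=> /l1s /ffunP /(_ w); rewrite !ffunE.
have cat2E (m1 : {ffun J1 -> option L}) (m2 : {ffun J2 -> option L}) x :
    line_point (cat2 _ m1 m2) x = cat2 _ (line_point m1 x) (line_point m2 x).
  by apply/ffunP => -[] j; rewrite !ffunE.
pose cst (J : finType) (w : {ffun J -> L}) : {ffun J -> option L} :=
  [ffun j => Some (w j)].
have cstE (J : finType) (w : {ffun J -> L}) x : line_point (cst J w) x = w.
  by apply/ffunP => j; rewrite !ffunE.
have lineR m1 (m2 : {ffun J2 -> option L}) : is_line m2 -> is_line (cat2 _ m1 m2).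
  by move=> /existsP[j jP]; apply/existsP; exists (inr j); rewrite ffunE.
have lineL (m1 : {ffun J1 -> option L}) m2 : is_line m1 -> is_line (cat2 _ m1 m2).
  by move=> /existsP[j jP]; apply/existsP; exists (inl j); rewrite ffunE.
pose chi0 w := chi (cat2 _ (line_point l1 b) w).
have [[l lP ls]|[w [cs [csU csS csP]]]] := IH chi0.
  left; exists (cat2 _ (cst _ (line_point l1 b)) l); first exact: lineR.
  by move=> x /ls; rewrite !cat2E !cstE.
have [c0P|c0P] := boolP (chi0 w \in cs).
  have [l [lP la ls]] := csP _ c0P.
  left; exists (cat2 _ (cst _ (line_point l1 b)) l); first exact: lineR.
  move=> x xs; rewrite !cat2E !cstE.
  rewrite -/(chi0 (line_point l x)) -/(chi0 (line_point l b)).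
  rewrite [in RHS]ls ?mem_head//; move: xs; rewrite inE => /orP[/eqP->|/ls//].
  by rewrite la.
right; exists (cat2 _ (line_point l1 a) w), (chi0 w :: cs).
split; [by rewrite /= c0P | by rewrite /= csS |] => c.
rewrite inE => /orP[/eqP->|/csP[l [lP la ls]]].
  exists (cat2 _ l1 (cst _ w)); split; first exact: lineL.
    by rewrite cat2E cstE.
  by move=> x xs; rewrite cat2E cstE l1E.
exists (cat2 _ l1 l); split; first exact: lineL.
  by rewrite cat2E la.
by move=> x xs; rewrite cat2E l1E// -[LHS]/(chi0 _) ls.
Qed.

Lemma hales_jewett_seq (L : finType) (b : L) (s : seq L) (C : finType) :
  exists J : finType, forall chi : {ffun J -> L} -> C, exists2 l, is_line l &
     {in b :: s, forall x, chi (line_point l x) = chi (line_point l b)}.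
Proof.
elim: s C => [|a s IH] C.
  exists unit => chi; exists [ffun=> None]; first by apply/existsP; exists tt; rewrite ffunE.
  by move=> x; rewrite inE => /eqP->.
have [J JP] := @hales_jewett_focus L C a b s IH #|C|.+1.
exists J => chi; have [[l lP ls]|[w [cs [csU csS _]]]] := JP chi.
  exists l => // x; rewrite !inE orbCA => xs; apply: ls; rewrite !inE; exact: xs.
by have := max_card (mem cs); rewrite (card_uniqP csU) csS ltnn.
Qed.

Lemma hales_jewett (L C : finType) :
  exists J : finType, forall chi : {ffun J -> L} -> C, exists2 l, is_line l &
    forall x y, chi (line_point l x) = chi (line_point l y).
Proof.
have [b _|L0] := pickP (@predT L); last first.
  exists unit => chi; exists [ffun=> None]; first by apply/existsP; exists tt; rewrite ffunE.
  by move=> x; have := L0 x.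
have [J JP] := hales_jewett_seq b (enum L) C.
exists J => chi; have [l lP ls] := JP chi; exists l => // x y.
by rewrite !ls// inE mem_enum orbT.
Qed.

Lemma ramsey (a b : nat) : exists N, forall (I : finType) (A : {set I}) (r : rel I),
  symmetric r -> N <= #|A| ->
  (exists s : seq I, [/\ uniq s, size s = a, {subset s <= A} &
     {in s &, forall x y, x != y -> r x y}]) \/
  (exists s : seq I, [/\ uniq s, size s = b, {subset s <= A} &
     {in s &, forall x y, x != y -> ~~ r x y}]).
Proof.
have [n] := ubnP (a + b); elim: n a b => // n IH [|a] b.
  by move=> _; exists 0 => I A r _ _; left; exists [::].
case: b => [_|b]; first by exists 0 => I A r _ _; right; exists [::].
rewrite ltnS => abn.
have [N1 N1P] : exists N, _ := IH a b.+1 abn.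
have [N2 N2P] : exists N, _ := IH a.+1 b (ltac:(by rewrite addSnnS)).
exists (N1 + N2).+1 => I A r rS cA.
have [x xA] : exists x, x \in A by apply/card_gt0P; apply: leq_ltn_trans cA.
have cD : N1 + N2 <= #|[set y in A :\ x | r x y]| + #|[set y in A :\ x | ~~ r x y]|.
  rewrite -cardsUI; set S := _ :|: _.
  have -> : S = A :\ x by apply/setP => y; rewrite !inE -andb_orr orbN andbT.
  by rewrite (leq_trans _ (leq_addr _ _))//; rewrite (cardsD1 x) xA in cA.
have subA (P : pred I) (s : seq I) : {subset s <= [set y in A :\ x | P y]} ->
    {subset x :: s <= A} /\ x \notin s.
  move=> sP; split; last by apply/negP => /sP; rewrite !inE eqxx.
  by move=> y; rewrite inE => /orP[/eqP->//|/sP]; rewrite !inE -andbA => /and3P[].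
have [c1|c1] := leqP N1 #|[set y in A :\ x | r x y]|.
  have [[s [sU sS sA sP]]|[s [sU sS sA sP]]] := N1P I _ r rS c1; last first.
    by right; exists s; split => // y ys; have [->//] := subA _ _ sA; rewrite inE ys orbT.
  have [sA' xs] := subA _ _ sA.
  left; exists (x :: s); split => //=; [by rewrite xs | by rewrite sS|].
  move=> y z; rewrite !inE => /orP[/eqP->|ys] /orP[/eqP->|zs]; rewrite ?eqxx// => yz.
  - by have := sA _ zs; rewrite !inE => /andP[].
  - by rewrite rS; have := sA _ ys; rewrite !inE => /andP[].
  - exact: sP.
have {c1}c2 : N2 <= #|[set y in A :\ x | ~~ r x y]|.
  by rewrite -(leq_add2l N1) (leq_trans cD)// leq_add2r ltnW.
have [[s [sU sS sA sP]]|[s [sU sS sA sP]]] := N2P I _ r rS c2.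
  by left; exists s; split => // y ys; have [->//] := subA _ _ sA; rewrite inE ys orbT.
have [sA' xs] := subA _ _ sA.
right; exists (x :: s); split => //=; [by rewrite xs | by rewrite sS|].
move=> y z; rewrite !inE => /orP[/eqP->|ys] /orP[/eqP->|zs]; rewrite ?eqxx// => yz.
- by have := sA _ zs; rewrite !inE => /andP[].
- by rewrite rS; have := sA _ ys; rewrite !inE => /andP[].
- exact: sP.
Qed.

(** * Homogeneity and universality of the random graph *)

Section RadoGraphs.
Variable V : choiceType.
Implicit Types (E : rel V) (s : seq V) (p : seq (V * V)).

Definition extension_property E := forall s (P : pred V),
  exists2 v, v \notin s & forall u, u \in s -> E v u = P u.

Definition rado E := [/\ symmetric E, irreflexive E & extension_property E].

Definition partial_iso E1 E2 p := {in p &, forall a b,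
  (a.1 == b.1) = (a.2 == b.2) /\ E1 a.1 b.1 = E2 a.2 b.2}.

Definition swap p := [seq (a.2, a.1) | a <- p].

Lemma mem_swap p x y : ((x, y) \in swap p) = ((y, x) \in p).
Proof.
apply/mapP/idP => [[[a b] abp [-> ->]]//|xyp].
by exists (y, x).
Qed.

Lemma partial_iso_swap E1 E2 p : partial_iso E1 E2 p -> partial_iso E2 E1 (swap p).
Proof.
by move=> pP [a b] [c d]; rewrite !mem_swap => h1 h2; have [/= -> ->] := pP _ _ h1 h2.
Qed.

Lemma partial_iso_cons E1 E2 p x y : rado E1 -> rado E2 -> partial_iso E1 E2 p ->
  (forall a, a \in p -> (x == a.1) = (y == a.2) /\ E1 x a.1 = E2 y a.2) ->
  partial_iso E1 E2 ((x, y) :: p).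
Proof.
move=> [S1 I1 _] [S2 I2 _] pP xyP a b; rewrite !inE.
move=> /orP[/eqP->|ap] /orP[/eqP->|bp] /=.
- by rewrite !eqxx I1 I2.
- exact: xyP.
- have [e1 e2] := xyP _ ap; split; first by rewrite eq_sym e1 eq_sym.
  by rewrite S1 e2 S2.
- exact: pP.
Qed.

Lemma partial_iso_forth E1 E2 p x : rado E1 -> rado E2 -> partial_iso E1 E2 p ->
  exists y, partial_iso E1 E2 ((x, y) :: p).
Proof.
move=> R1 R2 pP; have [/mapP[[x' y] xyp /= ->]|xp] := boolP (x \in map fst p).
  by exists y; apply: partial_iso_cons => // a ap; apply: pP xyp ap.
have [_ _ ext2] := R2.
have [y yp yP] := ext2 (map snd p) (fun u => has (fun a => (a.2 == u) && E1 x a.1) p).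
exists y; apply: partial_iso_cons => // a ap; split.
  apply/eqP/eqP => e; first by case/negP: xp; rewrite e map_f.
  by case/negP: yp; rewrite e map_f.
rewrite yP ?map_f//; apply/idP/hasP => [xa|[b bp /andP[/eqP e xb]]].
  by exists a; rewrite ?eqxx.
by have [] := pP _ _ bp ap; rewrite e eqxx => /eqP <-.
Qed.

Lemma back_and_forth (en : nat -> V) (ens : forall x, exists n, en n = x)
    E1 E2 p : rado E1 -> rado E2 -> partial_iso E1 E2 p ->
  exists g : V -> V, [/\ bijective g, forall x y, E2 (g x) (g y) = E1 x y &
    forall x y, (x, y) \in p -> g x = y].
Proof.
move=> R1 R2 pP.
have /choice[F FP] (qx : seq (V * V) * V) : exists q, partial_iso E1 E2 qx.1 ->
    [/\ partial_iso E1 E2 q, {subset qx.1 <= q},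
      exists y, (qx.2, y) \in q & exists z, (z, qx.2) \in q].
  case: qx => q x; have [/= qP|nqP] := pselect (partial_iso E1 E2 q); last by exists q.
  have [y yP] := partial_iso_forth x R1 R2 qP.
  have [z /partial_iso_swap zP] := partial_iso_forth x R2 R1 (partial_iso_swap yP).
  have sw q' : swap (swap q') = q' by rewrite /swap -map_comp map_id_in// => -[].
  exists ((z, x) :: (x, y) :: q) => _; split.
  - by move: zP; rewrite /swap/= -/(swap _) -/(swap q) sw.
  - by move=> a aq; rewrite !inE aq !orbT.
  - by exists y; rewrite !inE eqxx orbT.
  - by exists z; rewrite inE eqxx.
pose Q := fix Q n := if n is n'.+1 then F (Q n', en n') else p.
have QP n : partial_iso E1 E2 (Q n).
  by elim: n => //= n QnP; have [] := FP (Q n, en n) QnP.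
have Qsub m n : m <= n -> {subset Q m <= Q n}.
  elim: n => [|n IH]; first by rewrite leqn0 => /eqP->.
  rewrite leq_eqVlt => /orP[/eqP->//|/IH mn] a /mn an.
  by have [_ sub _ _] := FP (Q n, en n) (QP n); apply: sub.
have /choice[g gP] x : exists y, exists n, (x, y) \in Q n.
  have [n <-] := ens x; have [_ _ [y yP] _] := FP (Q n, en n) (QP n).
  by exists y, n.+1.
have /choice[h hP] y : exists x, exists n, (x, y) \in Q n.
  have [n <-] := ens y; have [_ _ _ [x xP]] := FP (Q n, en n) (QP n).
  by exists x, n.+1.
have QQ a b : (exists n, a \in Q n) -> (exists n, b \in Q n) ->
    (a.1 == b.1) = (a.2 == b.2) /\ E1 a.1 b.1 = E2 a.2 b.2.
  move=> [m am] [n bn]; apply: (QP (maxn m n)).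
    by apply: Qsub am; rewrite leq_maxl.
  by apply: Qsub bn; rewrite leq_maxr.
exists g; split.
- exists h => x; apply/eqP.
    by have [/= -> _] := QQ _ _ (hP (g x)) (gP x).
  by have [/= <- _] := QQ _ _ (gP (h x)) (hP x).
- by move=> x y; have [_ /= ->] := QQ _ _ (gP x) (gP y).
- move=> x y xyp; apply/eqP.
  have xyQ : exists n, (x, y) \in Q n by exists 0.
  by have [/= <- _] := QQ _ _ (gP x) xyQ.
Qed.

Definition realizes (I : finType) E (G : rel I) (phi : I -> V) :=
  injective phi /\ forall i j, i != j -> E (phi i) (phi j) = G i j.

Lemma finite_iso_extends (en : nat -> V) (ens : forall x, exists n, en n = x)
    E1 E2 (I : finType) (phi psi : I -> V) : rado E1 -> rado E2 ->
  injective phi -> realizes E2 (fun i j => E1 (phi i) (phi j)) psi ->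
  exists g : V -> V, [/\ bijective g, forall x y, E2 (g x) (g y) = E1 x y &
    forall i, g (phi i) = psi i].
Proof.
move=> R1 R2 phiI [psiI psiP].
have [|g [gb gE gP]] := @back_and_forth en ens E1 E2 [seq (phi i, psi i) | i <- enum I] R1 R2.
  move=> a b /mapP[i _ ->] /mapP[j _ ->] /=; rewrite !inj_eq//; split => //.
  have [->|ij] := eqVneq i j; last by rewrite psiP.
  by case: R1 => _ -> _; case: R2 => _ ->.
exists g; split => // i; apply: gP.
by apply/mapP; exists i; rewrite ?mem_enum.
Qed.

Lemma finite_embedding E s (I : finType) (G : rel I) (tau : I -> pred V) :
  rado E -> symmetric G ->
  exists phi, [/\ realizes E G phi, forall i, phi i \notin s &
    forall i x, x \in s -> E (phi i) x = tau i x].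
Proof.
move=> [ES EI ext] GS.
suff [phi [p1 p2 p3 p4]] : exists phi, [/\
    {in enum I &, injective phi},
    {in enum I &, forall i j, i != j -> E (phi i) (phi j) = G i j},
    {in enum I, forall i, phi i \notin s} &
    {in enum I, forall i x, x \in s -> E (phi i) x = tau i x}].
  exists phi; split => [|i|i]; [|exact: p3 (mem_enum _ i)|exact: p4 (mem_enum _ i)].
  by split => i j; [exact: p1 (mem_enum _ i) (mem_enum _ j)|
                    exact: p2 (mem_enum _ i) (mem_enum _ j)].
elim: (enum I) (enum_uniq I) => [_|a l IH /= /andP[al lU]].
  by have [v _ _] := ext [::] xpredT; exists (fun=> v); split.
have [phi [p1 p2 p3 p4]] := IH lU.
have [v vs vP] := ext (s ++ map phi l) (fun u =>
  if u \in s then tau a u else has (fun i => (phi i == u) && G a i) l).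
move: vs; rewrite mem_cat negb_or => /andP[vs vl].
have vG i : i \in l -> E v (phi i) = G a i.
  move=> il; rewrite vP ?mem_cat ?map_f ?orbT// (negbTE (p3 _ il)).
  apply/hasP/idP => [[j jl /andP[/eqP /p1 ->//]]|ai].
  by exists i; rewrite ?eqxx.
exists (fun i => if i == a then v else phi i); split.
- move=> i j; rewrite !inE; case: eqP => [->|_]; case: eqP => [->//|_] //=.
  + by move=> _ jl e; case/negP: vl; rewrite e map_f.
  + by move=> il _ e; case/negP: vl; rewrite -e map_f.
  + exact: p1.
- move=> i j; rewrite !inE; case: eqP => [->|_]; case: eqP => [->|_] //=.
  + by rewrite eqxx.
  + by move=> _ jl _; exact: vG.
  + by move=> il _ _; rewrite ES vG// GS.
  + exact: p2.
- by move=> i; rewrite inE; case: eqP => //= _; exact: p3.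
- move=> i; rewrite inE; case: eqP => [-> _ x xs|_ /= il x xs]; last exact: p4.
  by rewrite vP ?mem_cat ?xs.
Qed.

End RadoGraphs.

(** * Canonical behaviour on finite graphs *)

Section CanonicalCopies.
Variables (V : choiceType) (E : rel V).
Hypothesis radoE : rado E.

Definition pair_kind (I T : finType) (part : T -> I) (adj : rel T)
    (q : I * I * bool) (t u : T) :=
  [&& part t == q.1.1, part u == q.1.2 & adj t u == q.2].

Lemma partite_homogeneous (s : seq V) (I : finType) (tau : I -> pred V)
    (C : finType) (chi : V -> V -> C) (Q : seq (I * I * bool)) :
  all (fun q => q.1.1 != q.1.2) Q ->
  forall (T : finType) (part : T -> I) (adj : rel T), symmetric adj ->
  exists phi : T -> V, [/\ injective phi, forall t, phi t \notin s,
    forall t x, x \in s -> E (phi t) x = tau (part t) x,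
    forall t u, part t != part u -> E (phi t) (phi u) = adj t u &
    {in Q, forall q t u t' u', pair_kind part adj q t u ->
      pair_kind part adj q t' u' ->
      chi (phi t) (phi u) = chi (phi t') (phi u')}].
Proof.
elim: Q => [_ T part adj adjS|[[i j] b] Q IH /= /andP[ij Qij] T part adj adjS].
  have [phi [[phiI phiE] phis phiT]] := finite_embedding s (tau \o part) radoE adjS.
  exists phi; split => // t u; have [->|tu _] := eqVneq t u; first by rewrite eqxx.
  exact: phiE.
pose L := {p : T * T | pair_kind part adj (i, j, b) p.1 p.2}.
have [J JP] := hales_jewett L C.
(* The line [l] carries a copy of the structure: parts [i] and [j] go to its points, every other part has a private copy for each line. *)
pose emb (l : {ffun J -> option L}) (t : T) :
    ({ffun J -> T} + {ffun J -> option L} * T)%type :=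
  if part t == i then inl [ffun k => if l k is Some p then (val p).1 else t] else
  if part t == j then inl [ffun k => if l k is Some p then (val p).2 else t] else
  inr (l, t).
pose part' (a : ({ffun J -> T} + {ffun J -> option L} * T)%type) :=
  match a with
  | inl w => if [forall k, part (w k) == i] then i else j
  | inr lt => part lt.2
  end.
pose adj' (a a' : ({ffun J -> T} + {ffun J -> option L} * T)%type) :=
  match a, a' with
  | inl w, inl w' => [forall k, adj (w k) (w' k) == b] == b
  | _, _ => [exists l, exists t, exists u,
      [&& is_line l, a == emb l t, a' == emb l u & adj t u]]
  end.
have LP (p : L) : [/\ part (val p).1 = i, part (val p).2 = j & adj (val p).1 (val p).2 = b].
  by case: p => p /= /and3P[/eqP-> /eqP-> /eqP->].
have ji : (j == i) = false by rewrite eq_sym (negbTE ij).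
have embI l : is_line l -> injective (emb l).
  move=> /existsP[k /eqP lk] t u; rewrite /emb.
  case: eqP => ti; case: eqP => ui; do ?case: eqP => ? //.
  - by case=> /ffunP/(_ k); rewrite !ffunE lk.
  - by case=> /ffunP/(_ k); rewrite !ffunE lk.
  - by case=> /ffunP/(_ k); rewrite !ffunE lk.
  - by case=> /ffunP/(_ k); rewrite !ffunE lk.
  - by case.
have part'E l t : is_line l -> part' (emb l t) = part t.
  move=> /existsP[k /eqP lk]; rewrite /emb.
  case: (eqVneq (part t) i) => [ti|ti] /=.
    rewrite ti ifT//; apply/forallP => k'; rewrite ffunE.
    by case: (l k') => [p|]; [have [->] := LP p|rewrite ti].
  case: (eqVneq (part t) j) => [tj|tj] //=.
  by rewrite ifF//; apply/negP => /forallP/(_ k); rewrite ffunE lk tj ji.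
have adj'S : symmetric adj'.
  have aux a a' : [exists l, exists t, exists u,
      [&& is_line l, a == emb l t, a' == emb l u & adj t u]] ->
    [exists l, exists t, exists u,
      [&& is_line l, a' == emb l t, a == emb l u & adj t u]].
    move=> /existsP[l /existsP[t /existsP[u /and4P[h1 h2 h3 h4]]]].
    apply/existsP; exists l; apply/existsP; exists u; apply/existsP; exists t.
    by rewrite h1 h2 h3 adjS h4.
  move=> [w|lt] [w'|lt'] /=; [|by apply/idP/idP; exact: aux..].
  by congr (_ == _); apply: eq_forallb => k; rewrite adjS.
have adj'E l t u : is_line l -> part t != part u -> adj' (emb l t) (emb l u) = adj t u.
  move=> lP.
  have other t' u' : part u' != i -> part u' != j ->
      adj' (emb l t') (emb l u') = adj t' u'.
    move=> ui uj; have uE : emb l u' = inr (l, u').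
      by rewrite /emb (negbTE ui) (negbTE uj).
    have -> : adj' (emb l t') (emb l u') = [exists l0, exists x, exists y,
        [&& is_line l0, emb l t' == emb l0 x, emb l u' == emb l0 y & adj x y]].
      by rewrite uE /adj'; case: (emb l t').
    apply/existsP/idP => [[l0 /existsP[x /existsP[y]]]|tu'].
      move=> /and4P[l0P /eqP tx /eqP uy xy].
      have l0E : l0 = l.
        by move: uy; rewrite uE /emb; do 2?case: eqP => // _; case.
      by rewrite {}l0E in tx uy *; rewrite (embI _ lP _ _ tx) (embI _ lP _ _ uy).
    exists l; apply/existsP; exists t'; apply/existsP; exists u'.
    by rewrite lP !eqxx.
  have main t' u' : part t' = i -> part u' = j -> adj' (emb l t') (emb l u') = adj t' u'.
    move=> ti uj; rewrite /emb ti uj !eqxx ji /=.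
    have -> : [forall k, adj ([ffun k0 => if l k0 is Some p then (val p).1 else t'] k)
        ([ffun k0 => if l k0 is Some p then (val p).2 else u'] k) == b] = (adj t' u' == b).
      apply/forallP/idP => [h|tub k].
        by have /existsP[k /eqP lk] := lP; have := h k; rewrite !ffunE lk.
      by rewrite !ffunE; case: (l k) => // p; have [_ _ ->] := LP p.
    by case: (adj t' u'); case: (b).
  have [ti|ti] := eqVneq (part t) i; last have [tj|tj] := eqVneq (part t) j.
  - have [->|ui] := eqVneq (part u) i; first by rewrite ti eqxx.
    by have [uj|uj] := eqVneq (part u) j; [rewrite main|rewrite other].
  - have [ui|ui] := eqVneq (part u) i; first by rewrite adj'S main.
    by have [->|uj] := eqVneq (part u) j; [rewrite tj eqxx|rewrite other].
  - by rewrite adj'S other.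
have [phi [p1 p2 p3 p4 p5]] := IH Qij _ part' adj' adj'S.
pose word f (w : {ffun J -> L}) : {ffun J -> T} := [ffun k => f (val (w k))].
have [l lP lh] := JP (fun w => chi (phi (inl (word fst w))) (phi (inl (word snd w)))).
have embL t u (h : pair_kind part adj (i, j, b) t u) :
    emb l t = inl (word fst (line_point l (Sub (t, u) h))) /\
    emb l u = inl (word snd (line_point l (Sub (t, u) h))).
  have /and3P[/eqP/= ti /eqP/= uj _] := h; rewrite /emb ti uj !eqxx ji.
  by split; congr inl; apply/ffunP => k; rewrite !ffunE; case: (l k).
exists (phi \o emb l); split => [|t|t x xs|t u tu|q] /=.
- by move=> t u /p1; exact: embI.
- exact: p2.
- by rewrite p3// part'E.
- by rewrite p4 ?part'E// adj'E.
- rewrite inE => /orP[/eqP->|qQ] t u t' u' h h'.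
    have [-> ->] := embL _ _ h; have [-> ->] := embL _ _ h'; exact: lh.
  have qij : q.1.1 != q.1.2 by exact: (allP Qij).
  have kE v w : pair_kind part adj q v w -> pair_kind part' adj' q (emb l v) (emb l w).
    rewrite /pair_kind !part'E// => /and3P[/eqP vi /eqP wj /eqP <-].
    by rewrite vi wj adj'E ?eqxx// vi wj.
  by apply: (p5 q) => //; apply: kE.
Qed.

Lemma canonical_copies (s : seq V) (I : finType) (tau : I -> pred V) (f : V -> V) :
  exists (b : I -> I -> bool -> bool) (c : I -> pred V),
  forall G : rel I, symmetric G -> exists phi, [/\ realizes E G phi,
    forall i, phi i \notin s,
    forall i x, x \in s -> E (phi i) x = tau i x,
    forall i j, i != j -> E (f (phi i)) (f (phi j)) = b i j (G i j) &
    forall i x, x \in s -> E (f (phi i)) (f x) = c i x].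
Proof.
pose T := ({ffun I * I -> bool} * option I)%type.
(* The extra part [None], joined to everything, makes vertex colours visible in the colours of edges. *)
pose adj (t u : T) := (t.1 == u.1) && match t.2, u.2 with
  | Some i, Some j => t.1 (i, j) && t.1 (j, i) | _, _ => true end.
have adjS : symmetric adj.
  move=> [g o] [g' o']; rewrite /adj /= eq_sym; case: eqP => //= ->.
  by case: o o' => [i|] [j|] //=; rewrite andbC.
pose chi u v := (E (f u) (f v), map_tuple (fun x => E (f v) (f x)) (in_tuple s)).
pose Q := [seq q <- enum {: option I * option I * bool} | q.1.1 != q.1.2].
pose tau' (o : option I) : pred V := if o is Some i then tau i else xpred0.
have QP : all (fun q => q.1.1 != q.1.2) Q by apply/allP => q; rewrite mem_filter => /andP[].
have [phi [p1 p2 p3 p4 p5]] :=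
  @partite_homogeneous s _ tau' _ chi Q QP T snd adj adjS.
pose g t : {ffun I * I -> bool} := [ffun=> t].
have kind g1 g2 o o' t : o != o' -> adj (g1, o) (g1, o') = t -> adj (g2, o) (g2, o') = t ->
    chi (phi (g1, o)) (phi (g1, o')) = chi (phi (g2, o)) (phi (g2, o')).
  move=> oo' e1 e2; apply: (p5 (o, o', t)); first by rewrite mem_filter oo' mem_enum.
  by apply/and3P; split => //; apply/eqP.
  by apply/and3P; split => //; apply/eqP.
exists (fun i j t => E (f (phi (g t, Some i))) (f (phi (g t, Some j)))).
exists (fun i x => E (f (phi (g true, Some i))) (f x)) => G GS.
pose gG : {ffun I * I -> bool} := [ffun p => G p.1 p.2].
have adjG i j : adj (gG, Some i) (gG, Some j) = G i j.
  by rewrite /adj /= eqxx !ffunE /= [G j i]GS andbb.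
exists (fun i => phi (gG, Some i)); split.
- split=> [i j /p1 []//|i j ij].
  by rewrite p4//= adjG.
- by [].
- by move=> i x xs; rewrite p3.
- move=> i j ij; have gE : adj (g (G i j), Some i) (g (G i j), Some j) = G i j.
    by rewrite /adj /= eqxx !ffunE andbb.
  by have /(congr1 fst) := kind gG _ (Some i) (Some j) _ ij (adjG i j) gE.
- move=> i x xs; have nE h : adj (h, None) (h, Some i) = true by rewrite /adj /= eqxx.
  by have /(congr1 (fun p => val p.2)) /eq_in_map /(_ x xs) :=
    kind gG (g true) None (Some i) true isT (nE _) (nE _).
Qed.

End CanonicalCopies.

(** * Non-injective maps *)

Section Monoids.
Variables (V : choiceType) (E : rel V) (en : nat -> V) (M : set (V -> V)).
Hypothesis radoE : rado E.
Hypothesis ens : forall x, exists n, en n = x.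
Hypothesis M_id : M id.
Hypothesis M_comp : forall f g, M f -> M g -> M (f \o g).
Hypothesis M_closed : forall f,
  (forall s, uniq s -> exists2 e, M e & {in s, e =1 f}) -> M f.
Hypothesis M_aut : forall f, bijective f -> (forall x y, E (f x) (f y) = E x y) -> M f.

Lemma M_homogeneous (I : finType) (phi psi : I -> V) :
  injective phi -> realizes E (fun i j => E (phi i) (phi j)) psi ->
  exists f, [/\ M f, injective f, forall x y, E (f x) (f y) = E x y &
    forall i, f (phi i) = psi i].
Proof.
move=> phiI psiP; have [f [fb fE fP]] := finite_iso_extends ens radoE radoE phiI psiP.
by exists f; split => //; [exact: M_aut|exact: bij_inj].
Qed.

Lemma M_pair x y a b : x != y -> a != b -> E x y = E a b ->
  exists f, [/\ M f, f x = a & f y = b].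
Proof.
move=> xy ab Exy; have [ES _ _] := radoE.
pose pr (u v : V) (t : bool) := if t then u else v.
have prI u v : u != v -> injective (pr u v).
  by move=> uv [] [] //= e; move: uv; rewrite e eqxx.
have [|f [Mf _ _ fP]] := M_homogeneous (prI _ _ xy) (psi := pr a b).
  split; first exact: prI.
  by move=> [] [] //= _; rewrite ES -Exy ES.
by exists f; split => //; [exact: (fP true)|exact: (fP false)].
Qed.

Lemma M_constant c : (forall x y, exists2 e, M e & e x = e y) -> M (fun=> c).
Proof.
move=> coll; apply: M_closed => s _.
have [e Me es] : exists2 e, M e & {in s &, forall x y, e x = e y}.
  elim: s => [|x s [e Me es]]; first by exists id.
  case: s es => [|z s] es; first by exists id => // y y'; rewrite !inE => /eqP-> /eqP->.
  have [e' Me' e'x] := coll (e x) (e z).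
  exists (e' \o e); first exact: M_comp.
  have e'z y : y \in x :: z :: s -> e' (e y) = e' (e z).
    by rewrite inE => /orP[/eqP->//|ys]; rewrite (es y z) ?mem_head.
  by move=> y y' ys y's /=; rewrite !e'z.
case: s es => [|z s] es; first by exists id.
have [||a [Ma _ _ aP]] := @M_homogeneous unit (fun=> e z) (fun=> c).
- by move=> [] [].
- by split=> [[] []|[] []]//.
exists (a \o e) => [|x xs]; first exact: M_comp.
by rewrite /= (es x z) ?mem_head// (aP tt).
Qed.

Lemma M_homogeneous_map (h : bool) (g : V -> V) : injective g ->
  (forall x y, x != y -> E (g x) (g y) = h) ->
  (forall (I : finType) (phi : I -> V), injective phi ->
     exists2 e, M e & realizes E (fun _ _ => h) (e \o phi)) ->
  M g.
Proof.
move=> gI gE H; apply: M_closed => s sU.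
pose phi (i : 'I_(size s)) := tnth (in_tuple s) i.
have phiI : injective phi by apply/tuple_uniqP.
have [e Me [eI eE]] := H _ phi phiI.
have [//||a [Ma _ _ aP]] := @M_homogeneous _ (e \o phi) (g \o phi).
  split=> [|i j ij]; first exact: inj_comp.
  by rewrite eE// gE// inj_eq.
exists (a \o e) => [|x xs]; first exact: M_comp.
by have /tnthP[i ->] : x \in in_tuple s by []; exact: aP.
Qed.

Lemma M_kill_edges f a b : M f -> f a = f b -> a != b -> E a b ->
  (forall g c d, M g -> c != d -> ~~ E c d -> g c != g d) ->
  forall (I : finType) (phi : I -> V), injective phi ->
    exists2 e, M e & realizes E (fun _ _ => false) (e \o phi).
Proof.
move=> Mf fab ab Eab ncoll.
have [ES EI ext] := radoE.
have nonedge g c d : M g -> c != d -> ~~ E c d -> ~~ E (g c) (g d).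
  move=> Mg cd Ecd; apply/negP => gcd; have gcdI := ncoll g c d Mg cd Ecd.
  have [h [Mh hc hd]] := M_pair gcdI ab (etrans gcd (esym Eab)).
  have := ncoll (f \o h \o g) c d (M_comp (M_comp Mf Mh) Mg) cd Ecd.
  by rewrite /= hc hd fab eqxx.
have /choice[cm cmP] y : exists y', (y' != y /\ f y' = f y) \/
    (y' = y /\ forall z, f z = f y -> z = y).
  have [[y' y'P]|no] := pselect (exists y', y' != y /\ f y' = f y).
    by exists y'; left.
  exists y; right; split => // z zy; apply/eqP/negP => /negP zy'.
  by apply: no; exists z.
(* A copy is chosen inside a transversal of the kernel of [f] by keeping new points nonadjacent to some other element of the kernel class of each earlier point. *)
have grow p x : partial_iso E E p ->
    {in p &, forall u v, f u.2 = f v.2 -> u.2 = v.2} ->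
    exists y, partial_iso E E ((x, y) :: p) /\
      {in (x, y) :: p &, forall u v, f u.2 = f v.2 -> u.2 = v.2}.
  move=> pP pI; have [/mapP[[x' y] xyp /= ->]|xp] := boolP (x \in map fst p).
    exists y; split; first by apply: partial_iso_cons => // u up; apply: pP xyp up.
    have sub u : u \in (x', y) :: p -> u \in p by rewrite inE => /orP[/eqP->|].
    by move=> u v /sub up /sub vp; exact: pI.
  pose r := map snd p.
  have [y yr yP] := ext (r ++ map cm r) (fun u =>
    (u \in r) && has (fun a => (a.2 == u) && E x a.1) p).
  move: yr; rewrite mem_cat negb_or => /andP[yr ycr].
  have yI u : u \in p -> f y = f u.2 -> False.
    move=> up fyu; have ur : u.2 \in r by rewrite map_f.
    have cr : cm u.2 \in r ++ map cm r by rewrite mem_cat (map_f cm ur) orbT.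
    have [[cu fcu]|[_ /(_ _ fyu) e]] := cmP u.2; last by rewrite e ur in yr.
    have cnr : cm u.2 \notin r.
      by apply/negP => /mapP[v vp e]; case/eqP: cu; rewrite e; apply: pI => //; rewrite -e.
    have : f y != f (cm u.2).
      apply: ncoll => //; first by apply: contraNneq ycr => ->; rewrite map_f.
      by rewrite yP// (negbTE cnr).
    by rewrite fcu fyu eqxx.
  exists y; split.
    apply: partial_iso_cons => // u up; split.
      apply/eqP/eqP => e; first by case/negP: xp; rewrite e map_f.
      by case/negP: yr; rewrite e map_f.
    have ur : u.2 \in r by rewrite map_f.
    rewrite yP ?mem_cat ?ur//=; apply/idP/hasP => [xu|[v vp /andP[/eqP e xv]]].
      by exists u; rewrite ?eqxx.
    by have [] := pP _ _ vp up; rewrite e eqxx => /eqP <-.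
  move=> u v; rewrite !inE => /orP[/eqP->|up] /orP[/eqP->|vp] //=.
  - by move=> /(yI _ vp).
  - by move=> /esym /(yI _ up).
  - exact: pI.
have growl p (l : seq V) : partial_iso E E p ->
    {in p &, forall u v, f u.2 = f v.2 -> u.2 = v.2} ->
    exists q, [/\ partial_iso E E q, {subset p <= q},
      {in l, forall x, exists y, (x, y) \in q} &
      {in q &, forall u v, f u.2 = f v.2 -> u.2 = v.2}].
  elim: l p => [|x l IH] p pP pI; first by exists p; split.
  have [y [yP yI]] := grow p x pP pI.
  have [q [q1 q2 q3 q4]] := IH _ yP yI.
  exists q; split => // [u up|z]; first by apply: q2; rewrite inE up orbT.
  by rewrite inE => /orP[/eqP->|/q3//]; exists y; apply: q2; rewrite mem_head.
have kill (I : finType) (phi : I -> V) i j : injective phi -> i != j ->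
    E (phi i) (phi j) -> exists2 e, M e & injective (e \o phi) /\ ~~ E (e (phi i)) (e (phi j)).
  move=> phiI ij Eij.
  have [c cab cP] := ext [:: a; b] (pred1 b).
  have Ecb : E c b by rewrite cP ?inE ?eqxx ?orbT.
  have Eca : ~~ E c a by rewrite cP ?inE ?eqxx //= (negbTE ab).
  have ca : c != a by apply: contraNneq cab => ->; rewrite inE eqxx.
  have fca : f c != f b by rewrite -fab; apply: ncoll.
  have p0P : partial_iso E E [:: (phi i, b); (phi j, c)].
    have R : partial_iso E E [::] by [].
    apply: partial_iso_cons => //; first by apply: partial_iso_cons.
    move=> u; rewrite inE => /eqP-> /=; rewrite Eij ES Ecb; split => //.
    rewrite inj_eq// (negbTE ij); apply/esym/negbTE.
    by apply: contraNneq cab => <-; rewrite !inE eqxx orbT.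
  have [|q [q1 q2 q3 q4]] := growl _ (codom phi) p0P.
    move=> u v; rewrite !inE => /orP[]/eqP-> /orP[]/eqP-> //= e;
      by rewrite e eqxx in fca.
  have [g [gb gE gP]] := back_and_forth ens radoE radoE q1.
  have gq k : (phi k, g (phi k)) \in q.
    by have [y yq] := q3 _ (codom_f phi k); rewrite (gP _ _ yq).
  exists (f \o g); first by apply: M_comp => //; exact: M_aut.
  split=> [k k' /(q4 _ _ (gq k) (gq k'))/= e|/=].
    by apply: phiI; apply: (bij_inj gb).
  have -> : g (phi i) = b by apply: gP; apply: q2; rewrite inE eqxx.
  have -> : g (phi j) = c by apply: gP; apply: q2; rewrite !inE eqxx orbT.
  by rewrite -fab ES; apply: nonedge.
move=> I phi phiI.
suff [e Me [eI eP]] : exists2 e, M e & injective (e \o phi) /\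
    {in enum {: I * I}, forall q, q.1 != q.2 -> ~~ E (e (phi q.1)) (e (phi q.2))}.
  exists e => //; split => // i j ij.
  by apply/negbTE; apply: (eP (i, j)) ij; rewrite mem_enum.
elim: (enum _) => [|[i j] l [e Me [eI el]]]; first by exists id.
have [->|ij] := eqVneq i j.
  by exists e => //; split => // q; rewrite inE => /orP[/eqP->|/el//]; rewrite /= eqxx.
have [eij|eij] := boolP (E (e (phi i)) (e (phi j))); last first.
  by exists e => //; split => // q; rewrite inE => /orP[/eqP->|/el//].
have [e' Me' [e'I e'P]] := kill _ _ _ _ eI ij eij.
exists (e' \o e); first exact: M_comp.
split => // q; rewrite inE => /orP[/eqP->//|ql qq].
apply: (nonedge e' (e (phi q.1)) (e (phi q.2))) => //; last exact: el.
by rewrite (inj_eq eI).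
Qed.

End Monoids.

(** * Patterns *)

Lemma injection_of_card (K I : finType) : #|K| <= #|I| -> exists g : K -> I, injective g.
Proof.
move=> KI; exists (fun k => enum_val (widen_ord KI (enum_rank k))) => k l.
by move=> /enum_val_inj /(congr1 val) /= /ord_inj /enum_rank_inj.
Qed.

Lemma perm_of_pairs (I : finType) (x y x' y' : I) : x != y -> x' != y' ->
  exists s : {perm I}, s x = x' /\ s y = y'.
Proof.
move=> xy xy'; exists (tperm x x' * tperm (tperm x x' y) y')%g.
rewrite !permM tpermL; split; last by rewrite tpermL.
rewrite tpermD// 1?eq_sym// -[X in X != _](tpermL x x').
by rewrite inj_eq//; exact: perm_inj.
Qed.

Section Patterns.
Variables (V : choiceType) (E : rel V) (en : nat -> V) (M : set (V -> V)).
Hypothesis radoE : rado E.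
Hypothesis ens : forall x, exists n, en n = x.
Hypothesis M_id : M id.
Hypothesis M_comp : forall f g, M f -> M g -> M (f \o g).
Hypothesis M_aut : forall f, bijective f -> (forall x y, E (f x) (f y) = E x y) -> M f.
Hypothesis M_inj : forall f, M f -> injective f.

Definition reach (I : finType) (G H : rel I) := forall phi, realizes E G phi ->
  exists2 e, M e & realizes E H (e \o phi).

Lemma realizes_eq (I : finType) (G H : rel I) phi :
  (forall i j, i != j -> G i j = H i j) -> realizes E G phi -> realizes E H phi.
Proof. by move=> GH [phiI phiE]; split => // i j ij; rewrite phiE// GH. Qed.

Lemma reach_intro (I : finType) (G H : rel I) phi e : realizes E G phi -> M e ->
  (forall i j, i != j -> E (e (phi i)) (e (phi j)) = H i j) -> reach G H.
Proof.
move=> [phiI phiE] Me eH psi [psiI psiE].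
have [|a [Ma aI _ aP]] := M_homogeneous radoE ens M_aut psiI (psi := phi).
  by split => // i j ij; rewrite phiE// psiE.
exists (e \o a); first exact: M_comp.
split=> [|i j ij]; first by apply: inj_comp => //; apply: inj_comp => //; exact: M_inj.
by rewrite /= !aP eH.
Qed.

Lemma reach_refl (I : finType) (G : rel I) : reach G G.
Proof. by move=> phi phiP; exists id. Qed.

Lemma reach_trans (I : finType) (G H K : rel I) : reach G H -> reach H K -> reach G K.
Proof.
move=> GH HK phi /GH[e Me /HK[e' Me' eP]].
by exists (e' \o e) => //; exact: M_comp.
Qed.

Lemma reach_eq (I : finType) (G H K : rel I) : (forall i j, i != j -> H i j = K i j) ->
  reach G H -> reach G K.
Proof. by move=> HK GH phi /GH[e Me /(realizes_eq HK) eP]; exists e. Qed.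

Lemma reach_sub (I K : finType) (g : K -> I) (G H : rel I) (G' H' : rel K) :
  injective g -> symmetric G -> reach G H ->
  (forall k l, k != l -> G' k l = G (g k) (g l)) ->
  (forall k l, k != l -> H' k l = H (g k) (g l)) -> reach G' H'.
Proof.
move=> gI GS GH G'E H'E.
have [phi [phiP _ _]] := finite_embedding [::] (fun=> xpred0) radoE GS.
have [e Me [_ eE]] := GH _ phiP; have [phiI phiE] := phiP.
apply: (@reach_intro _ _ _ (phi \o g) e) => // [|k l kl /=].
  split=> [|k l kl /=]; first exact: inj_comp.
  by rewrite phiE ?inj_eq// G'E.
by rewrite eE ?inj_eq// H'E.
Qed.

Lemma reach_sym (I : finType) (G H : rel I) i j : symmetric G -> reach G H -> i != j ->
  H i j = H j i.
Proof.
move=> GS GH ij; have [phi [phiP _ _]] := finite_embedding [::] (fun=> xpred0) radoE GS.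
have [e Me [_ eE]] := GH _ phiP; have [ES _ _] := radoE.
by rewrite -eE// ES eE// eq_sym.
Qed.

Definition pattern (I : finType) (b : I -> I -> bool -> bool) :=
  forall G : rel I, symmetric G -> reach G (fun i j => b i j (G i j)).

Lemma pattern_reach (I : finType) b (G : rel I) : pattern b ->
  reach G (fun i j => b i j (G i j)).
Proof.
move=> bP phi [phiI phiE]; have [ES _ _] := radoE.
have [||e Me eP] := bP (fun i j => E (phi i) (phi j)) _ phi.
- by move=> i j; exact: ES.
- by [].
by exists e => //; apply: realizes_eq eP => i j ij; rewrite phiE.
Qed.

Lemma pattern_comp (I : finType) b c : @pattern I b -> @pattern I c ->
  pattern (fun i j t => c i j (b i j t)).
Proof.
move=> bP cP G GS; apply: reach_trans (bP G GS) _; exact: (@pattern_reach _ _ _ cP).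
Qed.

Lemma pattern_eq (I : finType) (b c : I -> I -> bool -> bool) :
  (forall i j t, i != j -> b i j t = c i j t) -> pattern b -> pattern c.
Proof. by move=> bc bP G GS; apply: reach_eq (bP G GS) => i j ij; exact: bc. Qed.

Lemma pattern_sub (I K : finType) (g : K -> I) b : injective g -> @pattern I b ->
  pattern (fun k l => b (g k) (g l)).
Proof.
move=> gI bP G GS.
pose G' i j := [exists k, exists l, [&& g k == i, g l == j & G k l]].
have G'E k l : G' (g k) (g l) = G k l.
  apply/existsP/idP => [[k' /existsP[l' /and3P[]]]|kl].
    by rewrite !inj_eq// => /eqP-> /eqP->.
  by exists k; apply/existsP; exists l; rewrite !eqxx.
have G'S : symmetric G'.
  have aux i j : G' i j -> G' j i.
    move=> /existsP[k /existsP[l /and3P[ki lj kl]]].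
    by apply/existsP; exists l; apply/existsP; exists k; rewrite ki lj GS.
  by move=> i j; apply/idP/idP; exact: aux.
by apply: (reach_sub gI G'S (bP G' G'S)) => k l kl; rewrite G'E.
Qed.

Definition no_constant_pattern n := forall (I : finType) b, n <= #|I| ->
  @pattern I b -> forall i j, i != j -> b i j true <> b i j false.

Lemma exists_no_constant_pattern :
  (forall h, ~ forall (I : finType) (phi : I -> V), injective phi ->
     exists2 e, M e & realizes E (fun _ _ => h) (e \o phi)) ->
  exists n, no_constant_pattern n.
Proof.
move=> noh; apply: contrapT => noconst.
have const1 n : exists (I : finType) b, [/\ n <= #|I|, @pattern I b &
    exists i j, i != j /\ b i j true = b i j false].
  apply: contrapT => no; apply: noconst; exists n => I b nI bP i j ij bij.
  by apply: no; exists I, b; split => //; exists i, j.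
have const n : exists (I : finType) b, [/\ n <= #|I|, @pattern I b &
    forall i j, i != j -> b i j true = b i j false].
  have [I [b0 [nI b0P [i0 [j0 [ij0 b0c]]]]]] := const1 n.
  suff [b [bP bc]] : exists b, @pattern I b /\
      {in enum {: I * I}, forall q, q.1 != q.2 -> b q.1 q.2 true = b q.1 q.2 false}.
    by exists I, b; split => // i j; apply: (bc (i, j)); rewrite mem_enum.
  elim: (enum _) => [|[i j] l [b [bP bc]]].
    by exists (fun _ _ t => t); split => // G _; exact: reach_refl.
  have [<-|ij] := eqVneq i j.
    by exists b; split => // q; rewrite inE => /orP[/eqP->|/bc//]; rewrite /= eqxx.
  have [s [si sj]] := perm_of_pairs ij ij0.
  exists (fun i j t => b0 (s i) (s j) (b i j t)); split.
    exact: (pattern_comp bP (pattern_sub (@perm_inj _ s) b0P)).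
  move=> q; rewrite inE => /orP[/eqP-> _|/bc bq /bq-> //] /=.
  by rewrite si sj; case: (b i j true); case: (b i j false).
have hom n : exists h, forall K : finType, #|K| <= n -> forall phi : K -> V,
    injective phi -> exists2 e, M e & realizes E (fun _ _ => h) (e \o phi).
  have [N NP] := ramsey n n; have [I [b [NI bP bc]]] := const N.
  pose r i j := (i == j) || b i j true.
  have rS : symmetric r.
    move=> i j; rewrite /r eq_sym; have [//|ij] := eqVneq j i.
    by rewrite /= (@reach_sym _ _ _ i j _ (bP (fun _ _ => true) _)) // eq_sym.
  suff [h [s [sU ss sh]]] : exists (h : bool) (s : seq I), [/\ uniq s, size s = n &
      {in s &, forall i j, i != j -> b i j true = h}].
    exists h => K Kn phi phiI.
    pose g (k : K) := tnth (in_tuple s) (cast_ord (esym ss) (widen_ord Kn (enum_rank k))).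
    have gI : injective g.
      have /tuple_uniqP tI : uniq (in_tuple s) by [].
      by move=> k l /tI /(congr1 val) /= /ord_inj /enum_rank_inj.
    have := @pattern_reach K _ (fun k l => E (phi k) (phi l)) (pattern_sub gI bP).
    move=> /(_ phi)[//|e Me eP]; exists e => //; apply: realizes_eq eP => k l kl.
    have gkl : g k != g l by rewrite inj_eq.
    have gs k' : g k' \in s by exact: (mem_tnth _ (in_tuple s)).
    by rewrite -(sh (g k) (g l))//; case: (E _ _); rewrite ?bc.
  have NI' : N <= #|[set: I]%SET| by rewrite cardsT.
  have [[s [sU ss _ sP]]|[s [sU ss _ sP]]] := NP I _ r rS NI'.
  - exists true, s; split => // i j si sj ij.
    by have := sP _ _ si sj ij; rewrite /r (negbTE ij).
  - exists false, s; split => // i j si sj ij.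
    by have := sP _ _ si sj ij; rewrite /r (negbTE ij) => /negbTE.
have /choice[n nP] (h : bool) : exists n, forall m, n <= m ->
    ~ forall K : finType, #|K| <= m -> forall phi : K -> V,
      injective phi -> exists2 e, M e & realizes E (fun _ _ => h) (e \o phi).
  apply: contrapT => no; apply: (noh h) => I phi phiI.
  apply: contrapT => nI; apply: no; exists #|I| => m Im /(_ I Im phi phiI).
  exact: nI.
have [h hP] := hom (maxn (n true) (n false)).
by apply: nP hP; case: h; rewrite ?leq_maxl ?leq_maxr.
Qed.

Definition flip (I : finType) (d : rel I) := pattern (fun i j t => t (+) d i j).

Lemma flip_eq (I : finType) (d d' : rel I) : (forall i j, i != j -> d i j = d' i j) ->
  flip d -> flip d'.
Proof. by move=> dd'; apply: pattern_eq => i j t ij; rewrite dd'. Qed.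

Lemma flip0 (I : finType) : flip (fun _ _ : I => false).
Proof. by move=> G _; apply: reach_eq (@reach_refl _ G) => i j _; rewrite addbF. Qed.

Lemma flip_add (I : finType) (d d' : rel I) : flip d -> flip d' ->
  flip (fun i j => d i j (+) d' i j).
Proof.
move=> dP d'P; apply: pattern_eq (pattern_comp dP d'P) => i j t _.
by rewrite addbA.
Qed.

Lemma flip_sub (I K : finType) (g : K -> I) (d : rel I) : injective g -> flip d ->
  flip (fun k l => d (g k) (g l)).
Proof. by move=> gI; exact: pattern_sub. Qed.

Lemma flip_sym (I : finType) (d : rel I) i j : flip d -> i != j -> d i j = d j i.
Proof. by move=> /(_ (fun _ _ => false) (fun _ _ => erefl)) /reach_sym; exact. Qed.

Lemma no_single_flip n (I : finType) (u w : I) (d : rel I) : no_constant_pattern n ->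
  n <= #|I| -> u != w -> d u w -> flip d ->
  ~ forall i j, i != j -> d i j -> (i == u) && (j == w) || (i == w) && (j == u).
Proof.
move=> nocst nI uw duw dP donly.
pose q i j := (i == u) && (j == w) || (i == w) && (j == u).
have qP : pattern (fun i j t => if q i j then false else t).
  move=> G GS; case Guw: (G u w).
    apply: reach_eq (dP G GS) => i j ij; case: ifPn => [|qij].
      move=> /orP[] /andP[/eqP-> /eqP->]; first by rewrite Guw duw.
      by rewrite GS Guw (flip_sym dP) ?duw// eq_sym.
    by have := donly i j ij; rewrite -/(q i j) (negbTE qij); case: (d i j) => [/(_ isT)|]; rewrite ?addbF.
  apply: reach_eq (@reach_refl _ G) => i j ij; case: ifP => //.
  by move=> /orP[] /andP[/eqP-> /eqP->]; rewrite // GS.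
by have := nocst _ _ nI qP u w uw; rewrite /q !eqxx.
Qed.

Lemma flip_rows n (I : finType) (d : rel I) u v w w' : no_constant_pattern n ->
  n.+2 <= #|I| -> flip d -> u != v -> w != u -> w != v -> w' != u -> w' != v ->
  d u w (+) d v w = d u w' (+) d v w'.
Proof.
move=> nocst nI dP; wlog: w w' / d u w (+) d v w.
  move=> H uv wu wv w'u w'v.
  have [h|/negbTE h] := boolP (d u w (+) d v w); first by rewrite -h; exact: H.
  have [h'|//] := boolP (d u w' (+) d v w').
  by rewrite -h -h'; apply/esym; exact: H.
move=> h uv wu wv w'u w'v; rewrite h; apply/esym; apply: contrapT => /negP/negbTE h'.
have ww' : w != w' by apply/eqP => e; rewrite e h' in h.
have dS i j : i != j -> d i j = d j i by exact: flip_sym.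
(* Adding to [d] its image under the transposition (u v), and then to the result its image under (w w'), leaves the 4-cycle u w v w'. *)
pose d1 i j := d i j (+) d (tperm u v i) (tperm u v j).
have d1P : flip d1 := flip_add dP (flip_sub (@perm_inj _ (tperm u v)) dP).
pose d2 i j := d1 i j (+) d1 (tperm w w' i) (tperm w w' j).
have d2P : flip d2 := flip_add d1P (flip_sub (@perm_inj _ (tperm w w')) d1P).
pose K := {x : I | (x != v) && (x != w')}.
have nK : n <= #|{: K}|.
  rewrite card_sig -(leq_add2l 2) (leq_trans nI)//.
  rewrite -(cardC (mem [:: v; w'])) leq_add ?card_size//.
  by rewrite subset_leq_card//; apply/fintype.subsetP => x; rewrite !inE negb_or.
have uK : (u != v) && (u != w') by rewrite uv eq_sym.
have wK : (w != v) && (w != w') by rewrite wv ww'.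
have uv' : v != u by rewrite eq_sym.
have ww'' : w' != w by rewrite eq_sym.
have uw' : u != w' by rewrite eq_sym.
have uw : u != w by rewrite eq_sym.
have vw : v != w by rewrite eq_sym.
have vw' : v != w' by rewrite eq_sym.
have d1z i j : i != u -> i != v -> j != u -> j != v -> d1 i j = false.
  by move=> *; rewrite /d1 !tpermD 1?eq_sym// addbb.
have d1u x : x != u -> x != v -> d1 u x = d u x (+) d v x.
  by move=> *; rewrite /d1 tpermL tpermD 1?eq_sym// addbb.
apply: (@no_single_flip n K (Sub u uK) (Sub w wK) (fun x y => d2 (val x) (val y)) nocst) => //.
- by rewrite /= /d2 tpermL tpermD// !d1u// h h'.
- exact: (flip_sub val_inj d2P).
move=> [i iK] [j jK]; rewrite -!val_eqE /= => ij.
have [iv iw'] := andP iK; have [jv jw'] := andP jK.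
apply: contraTT; rewrite negb_or !negb_and /d2.
have [eiu|iu] := eqVneq i u; have [eju|ju] := eqVneq j u => //=.
- by rewrite eiu eju eqxx in ij.
- by case/andP=> jw _; rewrite eiu !tpermD 1?eq_sym// addbb.
- by rewrite orbF => iw; rewrite eju !tpermD 1?eq_sym// addbb.
- have tu x : x != u -> tperm w w' x != u by move=> xu; case: tpermP.
  have tv x : x != v -> tperm w w' x != v by move=> xv; case: tpermP.
  by move=> _; rewrite !d1z ?tu ?tv.
Qed.

Lemma flip_cut n (I : finType) (d : rel I) : no_constant_pattern n ->
  n.+3 <= #|I| -> flip d -> exists (eps : bool) (X : pred I),
    forall i j, i != j -> d i j = eps (+) (X i (+) X j).
Proof.
move=> nocst nI dP; have dS i j : i != j -> d i j = d j i by exact: flip_sym.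
have rows u v w w' : u != v -> w != u -> w != v -> w' != u -> w' != v ->
    d u w (+) d v w = d u w' (+) d v w'.
  by apply: flip_rows nocst _ dP; exact: ltnW.
have /card_gt2P[u0 [u1 [u2 [_ [u01 u12 u20]]]]] : 2 < #|I| by apply: leq_trans nI.
have u10 : u1 != u0 by rewrite eq_sym.
pose T u v := d u0 u (+) d u0 v (+) d u v.
have TS u v : u != v -> T u v = T v u.
  by move=> uv; rewrite /T [d u v]dS// [d u0 u (+) _]addbC.
have Tswap u v v' : u != u0 -> v != u0 -> v' != u0 -> u != v -> u != v' ->
    T u v = T u v'.
  move=> *; rewrite /T -!addbA [d u0 v (+) _](rows _ _ _ v') //; by rewrite eq_sym.
have Tc u v : u != u0 -> v != u0 -> u != v -> T u v = T u1 u2.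
  move=> u_0 v_0 uv; have [e|uu1] := eqVneq u u1.
    by rewrite e; apply: Tswap => //; rewrite -e.
  by rewrite (Tswap u v u1)// TS//; apply: Tswap => //; rewrite eq_sym.
exists (T u1 u2), (fun i => (i != u0) && (d u0 i (+) T u1 u2)) => i j ij.
have [ei|i0] := eqVneq i u0; have [ej|j0] := eqVneq j u0 => /=.
- by rewrite ei ej eqxx in ij.
- by rewrite ei; case: (d _ _); case: (T _ _).
- by rewrite ej dS//; case: (d _ _); case: (T _ _).
- rewrite -(Tc i j)// /T.
  by case: (d u0 i); case: (d u0 j); case: (d i j).
Qed.

Definition cut (I : finType) (X : pred I) : rel I := fun i j => X i (+) X j.

Definition all_cuts := forall (I : finType) (X : pred I), flip (cut X).

Definition all_complements := forall I : finType, flip (fun _ _ : I => true).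

Lemma all_cuts_of_stars :
  (forall n, exists (I : finType) (x : I), n <= #|I| /\ flip (cut (pred1 x))) ->
  all_cuts.
Proof.
move=> stars.
have star (I : finType) (y : I) : flip (cut (pred1 y)).
  have [J [x [IJ xP]]] := stars #|I|; have [g gI] := injection_of_card IJ.
  have hI : injective (tperm (g y) x \o g) by apply: inj_comp => //; exact: perm_inj.
  apply: flip_eq (flip_sub hI xP) => i j _.
  have hx k : (tperm (g y) x (g k) == x) = (k == y).
    by rewrite -{2}(tpermL (g y) x) (inj_eq perm_inj) (inj_eq gI).
  by rewrite /cut /= !hx.
move=> I X.
suff H (l : seq I) : uniq l -> flip (cut (mem l)).
  by apply: flip_eq (H _ (enum_uniq X)) => i j _; rewrite /cut /= !mem_enum.
elim: l => [_|x l IH /= /andP[xl /IH lP]].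
  by apply: flip_eq (@flip0 I) => i j _; rewrite /cut.
apply: flip_eq (flip_add (star I x) lP) => i j _; rewrite /cut /= !inE.
have xE k : (k == x) || (k \in l) = (k == x) (+) (k \in l).
  by case: eqP => [->|//]; rewrite (negbTE xl).
by rewrite !xE; do 4![case: (_ == _) || case: (_ \in _)].
Qed.

Lemma all_complements_of_large :
  (forall n, exists I : finType, n <= #|I| /\ flip (fun _ _ : I => true)) ->
  all_complements.
Proof.
move=> compl I; have [J [IJ JP]] := compl #|I|; have [g gI] := injection_of_card IJ.
exact: flip_sub gI JP.
Qed.

Definition available (I : finType) (eps : bool) (X : pred I) :=
  (eps -> all_complements) /\ ((exists i, X i) -> all_cuts).

Lemma available_flip (I : finType) eps (X : pred I) : available eps X ->
  flip (fun i j => eps (+) cut X i j).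
Proof.
move=> [epsP XP]; apply: (@flip_add _ (fun _ _ => eps)).
  by case: eps epsP => [/(_ isT)|_]; [exact|exact: flip0].
have [/XP cutP|no] := pselect (exists i, X i); first exact: cutP.
have X0 i : X i = false by apply/negP => Xi; apply: no; exists i.
by apply: flip_eq (@flip0 I) => i j _; rewrite /cut !X0.
Qed.

Lemma large_flips_available n : no_constant_pattern n -> exists N, [/\ n <= N,
  forall (I : finType) (x : I), N <= #|I| -> flip (cut (pred1 x)) -> all_cuts &
  forall (I : finType) (d : rel I), N <= #|I| -> flip d -> exists eps X,
    (forall i j, i != j -> d i j = eps (+) cut X i j) /\ available eps X].
Proof.
move=> nocst.
have [n1 n1P] : exists n1, forall (I : finType) (x : I), n1 <= #|I| ->
    flip (cut (pred1 x)) -> all_cuts.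
  have [c|nc] := pselect all_cuts; first by exists 0.
  apply: contrapT => no; apply: nc; apply: all_cuts_of_stars => m.
  apply: contrapT => nI; apply: no; exists m => I x mI xP.
  by exfalso; apply: nI; exists I, x.
have [n2 n2P] : exists n2, forall I : finType, n2 <= #|I| ->
    flip (fun _ _ : I => true) -> all_complements.
  have [c|nc] := pselect all_complements; first by exists 0.
  apply: contrapT => no; apply: nc; apply: all_complements_of_large => m.
  apply: contrapT => nI; apply: no; exists m => I mI IP.
  by exfalso; apply: nI; exists I.
exists (n.+3 + n1.+1 + n2); split.
- by rewrite -addnA (leq_trans _ (leq_addr _ _))// -addn3 leq_addr.
- move=> I x NI; apply: n1P; apply: leq_trans NI.
  by rewrite -addnA (leq_trans _ (leq_addl _ _))// (leq_trans _ (leq_addr _ _)).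
move=> I d NI dP.
have nI : n.+3 <= #|I| by apply: leq_trans NI; rewrite -addnA leq_addr.
have n1I : n1 < #|I|.
  by apply: leq_trans NI; rewrite -addnA (leq_trans _ (leq_addl _ _))// leq_addr.
have n2I : n2 <= #|I| by apply: leq_trans NI; rewrite leq_addl.
have [eps [X dE]] := flip_cut nocst nI dP.
have [[u [v uvX]]|noX] := pselect (exists u v, X u != X v); last first.
  have Xc i j : X i = X j by apply/eqP/negP => /negP h; apply: noX; exists i, j.
  exists eps, xpred0; split; first by move=> i j /dE ->; rewrite (Xc i j) addbb.
  split=> [e|[]//]; apply: (n2P I n2I); apply: flip_eq dP => i j /dE ->.
  by rewrite (Xc i j) addbb addbF.
have uv : u != v by apply: contraNneq uvX => ->.
have cuts : all_cuts.
  have d1P := flip_add dP (flip_sub (@perm_inj _ (tperm u v)) dP).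
  apply: (n1P {x : I | x != v} (Sub u uv)).
    by rewrite card_sig -(leq_add2l 1) (leq_trans n1I)// -(cardC (pred1 v)) card1.
  apply: flip_eq (flip_sub val_inj d1P) => -[i iv] [j jv] /=.
  rewrite -!val_eqE /= => ij.
  have tX k : k != v -> X (tperm u v k) = X k (+) (k == u).
    move=> kv; case: tpermP => [->|e|/eqP/negbTE-> _]; last by rewrite addbF.
      by rewrite eqxx; move: uvX; case: (X u); case: (X v).
    by rewrite e eqxx in kv.
  rewrite !dE ?(inj_eq perm_inj)// !tX// /cut /= -!val_eqE /=.
  by case: (i == u); case: (j == u); case: (X i); case: (X j); case: eps {dE}.
exists eps, X; split => //; split => // e.
apply: (n2P I n2I); apply: flip_eq (flip_add dP (cuts I X)) => i j /dE ->.
by rewrite e /cut -addbA addbb.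
Qed.

End Patterns.

(** * Injective monoids *)

Section InjectiveMonoids.
Variables (V : choiceType) (E : rel V) (en : nat -> V) (M : set (V -> V)).
Hypothesis radoE : rado E.
Hypothesis ens : forall x, exists n, en n = x.
Hypothesis M_id : M id.
Hypothesis M_comp : forall f g, M f -> M g -> M (f \o g).
Hypothesis M_closed : forall f,
  (forall s, uniq s -> exists2 e, M e & {in s, e =1 f}) -> M f.
Hypothesis M_aut : forall f, bijective f -> (forall x y, E (f x) (f y) = E x y) -> M f.
Hypothesis M_inj : forall f, M f -> injective f.

Lemma switching_on_finite n (f : V -> V) (s : seq V) :
  no_constant_pattern E M n -> M f -> uniq s ->
  exists (eps : bool) (Y : pred V), [/\ forall x, Y x -> x \in s,
    {in s &, forall x y, x != y -> E (f x) (f y) = E x y (+) (eps (+) (Y x (+) Y y))},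
    eps -> all_complements E M & (exists x, Y x) -> all_cuts E M].
Proof.
move=> nocst Mf sU; have [ES EI ext] := radoE.
have [N [nN starN largeN]] := large_flips_available radoE ens M_id M_comp M_aut M_inj nocst.
pose F (a : 'I_(size s)) := tnth (in_tuple s) a.
have FI : injective F by apply/tuple_uniqP.
pose I : finType := ('I_N.+1 * {ffun 'I_(size s) -> bool})%type.
have NI : N <= #|I|.
  rewrite card_prod card_ord; apply: leq_trans (leqnSn N) _.
  by rewrite leq_pmulr//; apply/card_gt0P; exists [ffun=> true].
pose tau (i : I) x := [exists a, (F a == x) && i.2 a].
have tauE i a : tau i (F a) = i.2 a.
  apply/existsP/idP => [[a' /andP[/eqP/FI ->]]//|ia].
  by exists a; rewrite eqxx.
have Fs a : F a \in s by exact: (mem_tnth _ (in_tuple s)).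
have [b [c bcP]] := canonical_copies radoE s tau f.
have bP : pattern E M b.
  move=> G GS; have [phi [phiP _ _ phib _]] := bcP G GS.
  by apply: (reach_intro radoE ens M_comp M_aut M_inj phiP Mf).
have bE i j t : i != j -> b i j t = t (+) b i j false.
  move=> ij; have := nocst I b (leq_trans nN NI) bP i j ij.
  by case: t; case: (b i j true); case: (b i j false).
pose K : finType := ('I_(size s) + I)%type.
pose inner (k : K) := if k is inr _ then true else false.
pose G0 (k l : K) := match k, l with
  | inl a, inl a' => E (F a) (F a')
  | inl a, inr i | inr i, inl a => i.2 a
  | inr _, inr _ => false end.
pose D (k l : K) := match k, l with
  | inl a, inl a' => E (F a) (F a') (+) E (f (F a)) (f (F a'))
  | inl a, inr i | inr i, inl a => i.2 a (+) c i (F a)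
  | inr i, inr j => b i j false end.
(* [K] is [s] together with the places [I] around it. Only the pairs inside [I] can be prescribed, so a graph [G] is moved into [K] by a map [h] chosen according to [G]. *)
pose places (d : rel K) := forall (L : finType) (h : L -> K) (G : rel L),
  injective h -> symmetric G ->
  (forall k l, k != l -> ~~ (inner (h k) && inner (h l)) -> G k l = G0 (h k) (h l)) ->
  reach E M G (fun k l => G k l (+) d (h k) (h l)).
have placesD : places D.
  move=> L h G hI GS Gh.
  pose GI i j := [exists k, exists l, [&& h k == inr i, h l == inr j & G k l]].
  have GIS : symmetric GI.
    have aux i j : GI i j -> GI j i.
      move=> /existsP[k /existsP[l /and3P[ki lj kl]]].
      by apply/existsP; exists l; apply/existsP; exists k; rewrite ki lj GS.
    by move=> i j; apply/idP/idP; exact: aux.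
  have [phi [[phiI phiE] phis phit phib phic]] := bcP GI GIS.
  pose Phi (k : K) := match k with inl a => F a | inr i => phi i end.
  have PhiI : injective Phi.
    move=> [a|i] [a'|i'] /= e.
    - by rewrite (FI _ _ e).
    - by have := phis i'; rewrite -e Fs.
    - by have := phis i; rewrite e Fs.
    - by rewrite (phiI _ _ e).
  have GIE k l i j : h k = inr i -> h l = inr j -> GI i j = G k l.
    move=> ki lj; apply/existsP/idP => [[k' /existsP[l' /and3P[/eqP k'i /eqP l'j]]]|kl].
      by rewrite -ki in k'i; rewrite -lj in l'j; rewrite (hI _ _ k'i) (hI _ _ l'j).
    by exists k; apply/existsP; exists l; rewrite ki lj !eqxx.
  apply: (reach_intro radoE ens M_comp M_aut M_inj (phi := Phi \o h) _ Mf).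
    split=> [|k l kl /=]; first exact: inj_comp.
    have hkl : h k != h l by rewrite inj_eq.
    case hk: (h k) hkl => [a|i]; case hl: (h l) => [a'|j] hkl /=.
    - by rewrite Gh ?hk ?hl.
    - by rewrite Gh ?hk ?hl//= ES phit// tauE.
    - by rewrite Gh ?hk ?hl//= phit// tauE.
    - by rewrite phiE// (GIE k l).
  move=> k l kl /=; have hkl : h k != h l by rewrite inj_eq.
  case hk: (h k) hkl => [a|i]; case hl: (h l) => [a'|j] hkl /=.
  - by rewrite Gh ?hk ?hl//= addbA addbb.
  - by rewrite Gh ?hk ?hl//= addbA addbb ES phic.
  - by rewrite Gh ?hk ?hl//= addbA addbb phic.
  - by rewrite phib// bE// (GIE k l).
have places_flip d d' : places d -> flip E M d' -> places (fun k l => d k l (+) d' k l).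
  move=> dP d'P L h G hI GS Gh.
  apply: (reach_trans M_comp (dP L h G hI GS Gh)).
  have d'h := flip_sub radoE ens M_comp M_aut M_inj hI d'P.
  by apply: reach_eq (pattern_reach radoE d'h) => k l _; rewrite addbA.
have [eps [X [bX [epsP XP]]]] : exists eps X,
    (forall i j, i != j -> b i j false = eps (+) cut X i j) /\ available E M eps X.
  apply: (largeN I (fun i j => b i j false)) => //.
  by apply: pattern_eq bP => i j t ij; rewrite bE.
pose X' (k : K) := if k is inr i then X i else false.
have X'P : available E M eps X'.
  by split => // -[[//|i] Xi]; apply: XP; exists i.
pose D1 k l := D k l (+) (eps (+) cut X' k l).
have placesD1 : places D1.
  exact: places_flip _ _ placesD (available_flip radoE M_id M_comp X'P).
have D1I i j : i != j -> D1 (inr i) (inr j) = false.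
  by move=> ij; rewrite /D1 /= bX// addbb.
have D1S a i : D1 (inr i) (inl a) = D1 (inl a) (inr i).
  by rewrite /D1 /cut /= addbC addbF [LHS]addbC.
have cardL : n <= #|{: option 'I_N.+1}|.
  by rewrite card_option card_ord (leq_trans nN)// -addn2 leq_addr.
have D1row a (i i' : I) : i.2 a -> ~~ i'.2 a -> D1 (inl a) (inr i) = D1 (inl a) (inr i').
  move=> ia i'a; pose sg := tperm i.1 i'.1.
  pose r t l : I := if t then (l, i.2) else (sg l, i'.2).
  (* The place given to a vertex depends on whether it is joined to the vertex standing for [a], so a difference between the two places would make the entry at [Some i.1] constant. *)
  pose bb (k l : option 'I_N.+1) t := match k, l with
    | None, Some l | Some l, None => t (+) D1 (inl a) (inr (r t l))
    | _, _ => t end.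
  have ra t l : (r t l).2 a = t by case: t => /=; rewrite ?(negbTE i'a).
  have rI t t' l l' : r t l = r t' l' -> l = l'.
    move=> e; have tt' : t = t' by rewrite -(ra t l) e ra.
    by move: e; rewrite tt'; case: (t') => -[] // /perm_inj.
  have bbP : pattern E M bb.
    move=> G GS; pose h o : K := if o is Some l then inr (r (G None (Some l)) l) else inl a.
    apply: reach_eq (placesD1 _ h G _ GS _); last 2 first.
    - by move=> [l|] [l'|] //= [] /rI ->.
    - by move=> [l|] [l'|] //= _ _; rewrite ra// GS.
    move=> [l|] [l'|] //=; last by rewrite D1S GS.
    move=> ll'; rewrite D1I ?addbF//.
    by apply: contraNneq ll' => /rI ->.
  have := nocst _ bb cardL bbP None (Some i.1) isT.
  rewrite /bb /r tpermL -!surjective_pairing.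
  by case: (D1 _ _); case: (D1 _ _).
pose v a := D1 (inl a) (inr (ord0, [ffun=> true])).
have D1v a (i : I) : D1 (inl a) (inr i) = v a.
  pose cst t : I := (ord0, [ffun=> t]).
  have cstE t : (cst t).2 a = t by rewrite ffunE.
  have [ia|ia] := boolP (i.2 a); last by apply/esym; apply: (D1row a (cst true)); rewrite ?cstE.
  by transitivity (D1 (inl a) (inr (cst false))); [|apply/esym]; apply: D1row; rewrite ?cstE.
have vP a : v a -> all_cuts E M.
  move=> va; apply: (starN (option 'I_N.+1) None).
    by rewrite card_option card_ord -addn2 leq_addr.
  move=> G GS.
  pose h o : K := if o is Some l then inr (l, [ffun=> G None (Some l)]) else inl a.
  apply: reach_eq (placesD1 _ h G _ GS _); last 2 first.
  - by move=> [l|] [l'|] //= [] ->.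
  - by move=> [l|] [l'|] //= _ _; rewrite ffunE// GS.
  move=> [l|] [l'|] //=; rewrite /cut /= ?D1S ?D1v ?va// => ll'.
  by rewrite D1I//; apply: contraNneq ll' => -[->].
pose Y' (k : K) := if k is inl a then v a else false.
have Y'P : available E M false Y'.
  by split => // -[[a|//] va]; exact: vP va.
pose D2 k l := D1 k l (+) (false (+) cut Y' k l).
have placesD2 : places D2.
  exact: places_flip _ _ placesD1 (available_flip radoE M_id M_comp Y'P).
have D2I a k : k != inl a -> inner k -> D2 (inl a) k = false /\ D2 k (inl a) = false.
  by case: k => // i _ _; rewrite /D2 /cut /= D1S D1v addbF addbb.
have D2II i j : i != j -> D2 (inr i) (inr j) = false.
  by move=> ij; rewrite /D2 D1I.
have D2S a a' : D2 (inl a) (inl a') = D2 (inl a') (inl a).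
  by rewrite /D2 /D1 /D /cut /= ES [E (f _) _]ES [v a (+) _]addbC.
have D2F a a' : a != a' -> D2 (inl a) (inl a') = false.
  move=> aa'; apply/negP => Daa'.
  pose L : finType := option (option 'I_N.+1).
  pose bb (k l : L) t := match k, l with
    | None, Some None | Some None, None => ~~ E (F a) (F a')
    | _, _ => t end.
  have bbP : pattern E M bb.
    move=> G GS; have [GE|GE] := eqVneq (G None (Some None)) (E (F a) (F a')); last first.
      apply: reach_eq (reach_refl M_id (G := G)) => -[[l|]|] [[l'|]|] //= _.
        by rewrite GS; move: GE; case: (G _ _); case: (E _ _).
      by move: GE; case: (G _ _); case: (E _ _).
    pose h (o : L) : K := match o with
      | None => inl a | Some None => inl a'
      | Some (Some l) => inr (l, [ffun x =>
          if x == a then G None (Some (Some l)) else G (Some None) (Some (Some l))]) end.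
    have a'a : (a' == a) = false by rewrite eq_sym (negbTE aa').
    apply: reach_eq (placesD2 _ h G _ GS _); last 2 first.
    - move=> [[l|]|] [[l'|]|] //=; try by case=> e; rewrite e eqxx in aa'.
      by case=> ->.
    - move=> [[l|]|] [[l'|]|] //= _ _; rewrite ?ffunE ?eqxx ?a'a// GS//.
      by rewrite GE ES.
    have D2i x i : (D2 (inl x) (inr i) = false) * (D2 (inr i) (inl x) = false).
      by have [] := D2I x (inr i) isT isT.
    move=> [[l|]|] [[l'|]|] //= ll'; rewrite ?D2i ?addbF//.
    - by rewrite D2II ?addbF//; apply: contraNneq ll' => -[->].
    - by rewrite D2S Daa' GS GE addbT.
    - by rewrite Daa' GE addbT.
  have cardL' : n <= #|L|.
    by rewrite card_option (leq_trans cardL).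
  exact: (nocst L bb cardL' bbP None (Some None) isT).
exists eps, (fun x => [exists a, (F a == x) && v a]).
have YE a : [exists a', (F a' == F a) && v a'] = v a.
  apply/existsP/idP => [[a' /andP[/eqP/FI ->]]//|va].
  by exists a; rewrite eqxx.
split => // [x /existsP[a /andP[/eqP<- _]]//|x y xs ys xy|[x /existsP[a /andP[_ /vP]]]//].
have /tnthP[a xa] : x \in in_tuple s by [].
have /tnthP[a' ya'] : y \in in_tuple s by [].
have := D2F a a'; rewrite xa ya' -/(F a) -/(F a') !YE.
rewrite /D2 /D1 /cut /= => H.
have aa' : a != a' by apply: contraNneq xy => e; rewrite xa ya' e.
move: (H aa'); case: (E (F a) _); case: (E (f _) _); case: (eps); by case: (v a); case: (v a').
Qed.

Lemma bijection_on_finite n (f : V -> V) (s : seq V) :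
  no_constant_pattern E M n -> M f -> uniq s ->
  exists g, [/\ M g, bijective g & {in s, g =1 f}].
Proof.
move=> nocst Mf sU; have [ES EI ext] := radoE.
have [eps [Y [Ys fE epsP YP]]] := switching_on_finite nocst Mf sU.
pose E2 x y := (x != y) && (E x y (+) (eps (+) (Y x (+) Y y))).
have radoE2 : rado E2.
  split=> [x y|x|t P]; rewrite /E2; [by rewrite eq_sym ES [Y x (+) _]addbC|by rewrite eqxx|].
  have [w] := ext (t ++ s) (fun u => P u (+) (eps (+) Y u)).
  rewrite mem_cat negb_or => /andP[wt ws] wP; exists w => // u ut.
  have Yw : Y w = false by apply/negP => /Ys; apply/negP.
  have -> : w != u by apply: contraNneq wt => ->.
  by rewrite wP ?mem_cat ?ut// Yw /= -addbA addbb addbF.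
pose F (a : 'I_(size s)) := tnth (in_tuple s) a.
have FI : injective F by apply/tuple_uniqP.
have Fs a : F a \in s by exact: (mem_tnth _ (in_tuple s)).
have [|g [gb gE gP]] := finite_iso_extends (psi := f \o F) ens radoE2 radoE FI.
  split=> [|a a' aa' /=]; first by apply: inj_comp => //; exact: M_inj.
  have Faa' : F a != F a' by rewrite inj_eq.
  by rewrite fE// /E2 Faa'.
exists g; split => // [|x xs]; last by have /tnthP[a ->] : x \in in_tuple s by []; exact: gP.
apply: M_closed => t tU.
pose phi (i : 'I_(size t)) := tnth (in_tuple t) i.
have phiI : injective phi by apply/tuple_uniqP.
have av : available E M eps (Y \o phi).
  by split => // -[i Yi]; apply: YP; exists (phi i).
have fl := available_flip radoE M_id M_comp av.
have [//|e Me [eI eE]] := pattern_reach radoE fl (phi := phi) (G := fun i j => E (phi i) (phi j)).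
have [|a [Ma _ _ aP]] := M_homogeneous radoE ens M_aut eI (psi := g \o phi).
  split=> [|i j ij]; first by apply: inj_comp => //; exact: bij_inj.
  by rewrite eE//= gE /E2 inj_eq// ij.
exists (a \o e) => [|x xt]; first exact: M_comp.
by have /tnthP[i ->] : x \in in_tuple t by []; exact: aP.
Qed.

End InjectiveMonoids.

(** * The four cases *)

Local Open Scope classical_set_scope.

Lemma random_graph_rado (V : choiceType) (E : rel V) : random_graph E ->
  rado E /\ exists en : nat -> V, forall x, exists n, en n = x.
Proof.
move=> [[cV infV] ES EI ext]; have radoE : rado E.
  split=> // s P.
  have fin Q : finite_set [set x | x \in s /\ Q x].
    by apply: (sub_finite_set (B := [set` s])) => // x [].
  have [|v [vs v1 v2]] := ext _ _ (fin P) (fin (fun x => ~ P x)).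
    by apply/seteqP; split => // x [[_ Px] [_ /(_ Px)]].
  exists v => [|u us].
    apply/negP => sv; apply: vs; have [Pv|nPv] := pselect (P v); first by left.
    by right.
  have [Pu|/negP nPu] := boolP (P u); first by rewrite v1.
  by apply/negbTE; apply: v2.
split=> //; have /countable_injP[f fI] := cV.
have [_ _ ext'] := radoE; have [v0 _ _] := ext' [::] xpredT.
have /choice[en enP] n : exists x, forall y, f y = n -> x = y.
  have [[x fx]|no] := pselect (exists x, f x = n).
    by exists x => y fy; apply: fI; rewrite ?inE// fx.
  by exists v0 => y fy; case: no; exists y.
by exists en => x; exists (f x); exact: enP.
Qed.

Lemma rado_complement (V : choiceType) (E : rel V) : rado E ->
  rado (fun x y => (x != y) && ~~ E x y).
Proof.
move=> [ES EI ext]; split=> [x y|x|s P]; [by rewrite eq_sym ES|by rewrite eqxx|].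
have [v vs vP] := ext s (fun u => ~~ P u); exists v => // u us.
have -> : v != u by apply: contraNneq vs => ->.
by rewrite vP// negbK.
Qed.

Lemma locally_closed_monoid_cases (V : choiceType) (E : rel V) (hG : random_graph E)
  (eE eN : V -> V)
  (heE : injective eE /\ infinite_clique E (range eE))
  (heN : injective eN /\ infinite_independent E (range eN))
  (M : set (V -> V)) (hM : locally_closed_monoid M)
  (hAut : graph_aut E `<=` M) :
  (exists c : V, M (fun _ => c)) \/
  M eE \/
  M eN \/
  M = smallest (@locally_closed_monoid V) (M `&` @all_perms V).
Proof.
have [radoE [en ens]] := random_graph_rado hG.
have [[M_id M_comp] M_lc] := hM.
have M_closed f : (forall s, uniq s -> exists2 e, M e & {in s, e =1 f}) -> M f.
  move=> H; apply: M_lc => A /finite_seqP[s ->].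
  have [e Me es] := H (undup s) (undup_uniq s).
  by exists e => // x /= xs; apply: es; rewrite mem_undup.
have M_aut f : bijective f -> (forall x y, E (f x) (f y) = E x y) -> M f.
  by move=> fb fE; exact: hAut.
have [ES EI _] := radoE.
have homogE (h : bool) : (forall (I : finType) (phi : I -> V), injective phi ->
    exists2 e, M e & realizes E (fun _ _ => h) (e \o phi)) -> M (if h then eE else eN).
  move=> hP; apply: (M_homogeneous_map radoE ens M_comp M_closed M_aut _ _ hP).
    by case: (h); [case: heE|case: heN].
  move=> x y /eqP xy; case: (h).
    have [eI [_ eP]] := heE.
    by apply: eP; [exists x|exists y|move=> /eI].
  have [eI [_ eP]] := heN.
  by apply/negbTE; apply: eP; [exists x|exists y|move=> /eI].
pose collapses (h : bool) := exists f a b, [/\ M f, f a = f b, a != b & E a b = h].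
have [collE|ncollE] := pselect (collapses true);
    have [collN|ncollN] := pselect (collapses false).
- left; exists (en 0).
  apply: (M_constant radoE ens M_id M_comp M_closed M_aut) => x y.
  have [->|xy] := eqVneq x y; first by exists id.
  have [f [a [b [Mf fab ab Eab]]]] : collapses (E x y) by case: (E x y).
  have [h [Mh hx hy]] := M_pair radoE ens M_aut xy ab (esym Eab).
  exists (f \o h); first exact: M_comp.
  by rewrite /= hx hy.
- right; right; left; apply: (homogE false).
  have [f [a [b [Mf fab ab Eab]]]] := collE.
  apply: (M_kill_edges radoE ens M_id M_comp M_aut Mf fab ab Eab) => g c d Mg cd.
  move=> /negbTE Ecd; apply/eqP => gcd; apply: ncollN.
  by exists g, c, d.
- right; left; apply: (homogE true) => I phi phiI.
  have [f [a [b [Mf fab ab Eab]]]] := collN.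
  pose Ec x y := (x != y) && ~~ E x y.
  have Ec_aut g : bijective g -> (forall x y, Ec (g x) (g y) = Ec x y) -> M g.
    move=> gb gE; apply: M_aut => // x y; have := gE x y.
    rewrite /Ec (inj_eq (bij_inj gb)); have [->|_] := eqVneq x y; first by rewrite !EI.
    exact: negb_inj.
  have Ecab : Ec a b by rewrite /Ec ab Eab.
  have [|e Me [eI eP]] :=
    M_kill_edges (rado_complement radoE) ens M_id M_comp Ec_aut Mf fab ab Ecab _ phiI.
    move=> g c d Mg cd; rewrite /Ec cd negbK => Ecd.
    by apply/eqP => gcd; apply: ncollE; exists g, c, d.
  exists e => //; split => // i j ij; have := eP i j ij.
  by rewrite /= (inj_eq eI) ij => /negbFE.
have M_inj f : M f -> injective f.
  move=> Mf a b fab; apply/eqP/negP => /negP ab.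
  have [Eab|/negbTE Eab] := boolP (E a b); first by apply: ncollE; exists f, a, b.
  by apply: ncollN; exists f, a, b.
have [ME|nME] := pselect (M eE); first by right; left.
have [MN|nMN] := pselect (M eN); first by right; right; left.
have [|n nocst] := exists_no_constant_pattern radoE ens M_id M_comp M_aut M_inj.
  by case=> /homogE.
right; right; right; apply/seteqP; split => [f Mf N [[_ N_lc] MN]|]; last first.
  by apply: smallest_sub => // f [].
apply: N_lc => A /finite_seqP[s ->].
have [g [Mg gb gs]] := bijection_on_finite radoE ens M_id M_comp M_closed M_aut M_inj
  nocst Mf (undup_uniq s).
exists g; first exact: MN.
by move=> x /= xs; apply: gs; rewrite mem_undup.
Qed.

Theorem theorem1 (V : Type) (E : rel V) (hG : random_graph E)
  (eE eN : V -> V)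
  (heE : injective eE /\ infinite_clique E (range eE))
  (heN : injective eN /\ infinite_independent E (range eN))
  (M : set (V -> V)) (hM : locally_closed_monoid M)
  (hAut : graph_aut E `<=` M) :
  (exists c : V, M (fun _ => c)) \/
  M eE \/
  M eN \/
  M = smallest (@locally_closed_monoid V) (M `&` @all_perms V).
Proof. exact: (@locally_closed_monoid_cases {classic V} E). Qed.
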